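(* Let $k \geq 1$ be an integer and let $$p_k = p_k(z;x,y) = \prod_{r=1}^k \left(z - \left(\sqrt[k]{(-1)^k x} + \epsilon^r \sqrt[k]{(-1)^k y}\right)^k\right),$$ where $\epsilon$ is a primitive $k$-th root of unity, regarded as a polynomial in $x,y,z$ with integer coefficients. Then the Newton polyhedron of $p_k$ is the $k\Delta^2$-simplex $$k\Delta^2 = \left\{(t_0,t_1,t_2) \in \mathbb{R}^3 \;\middle|\; t_0+t_1+t_2 = k \text{ and } t_i \geq 0 \text{ for } i = 0,1,2\right\},$$ which is a regular (equilateral) triangle with sides of length $\sqrt{2}\,k$.
   Context: The $k$-valued group structure on $\mathbb{C}$ has multiplication given by the multiset $x*y = [(\sqrt[k]{x} + \epsilon^r \sqrt[k]{y})^k : 1 \leq r \leq k]$, where $\epsilon$ is a primitive $k$-th root of unity (the multiset does not depend on the choice of the $k$-th roots), with unit $0$ and inverse $\mathrm{inv}(x) = (-1)^k x$. The polynomial $p_k$ is $p_k(z;x,y) = \prod_{r=1}^k (z - (\mathrm{inv}(x)*\mathrm{inv}(y))_r)$, where $(u*v)_r$ denotes the $r$-th element of the multiset $u*v$; this is the product displayed in the claim. It is known that $p_k$ is a homogeneous polynomial of degree $k$ in $x,y,z$, symmetric in $x,y,z$, with integer coefficients. For a polynomial $f = \sum a_{i_1 i_2 i_3} x^{i_1} y^{i_2} z^{i_3} \in \mathbb{Z}[x,y,z]$, let $I_f$ be the set of multi-indices $(i_1,i_2,i_3)$ with $a_{i_1 i_2 i_3} \neq 0$; the Newton polyhedron of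 $f$ is the convex hull $N_f = \mathrm{Conv}(I_f) \subset \mathbb{R}^3$. *)

(* Defs.v *)
From HB Require Import structures.
From mathcomp Require Import all_boot all_order all_algebra.
From mathcomp Require Import complex mpoly.
From mathcomp Require Import classical_sets reals convex.
From mathcomp Require Import ring.

Set Implicit Arguments.
Unset Strict Implicit.
Unset Printing Implicit Defensive.

Import Order.TTheory GRing.Theory Num.Theory.

Local Open Scope ring_scope.
Local Open Scope classical_set_scope.

(* The variables 'X_0, 'X_1, 'X_2 of {mpoly int[3]} stand for x, y, z.
   [k.-root] is one fixed choice of k-th root; since [r] runs over all residues
   modulo [k], any other choice gives the same product.  Such a [p] exists:
   see [is_p_exists] below. *)
Definition is_p (C : numClosedFieldType) (k : nat) (eps : C)
    (p : {mpoly int[3]}) : Prop :=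
  forall x y z : C,
    (map_mpoly intr p).@[tnth [tuple x; y; z]] =
    \prod_(1 <= r < k.+1)
      (z - (k.-root ((-1) ^+ k * x) + eps ^+ r * k.-root ((-1) ^+ k * y)) ^+ k).

Definition convex_hull (R : numDomainType) (M : lmodType R) (A : set M) :
  set M := smallest (@convex_set R M) A.

Definition newton_polyhedron (R : numDomainType) (n : nat)
    (f : {mpoly int[n]}) : set 'rV[R]_n :=
  convex_hull [set \row_i (m i)%:R | m in [set m : 'X_{1..n} | f@_m != 0]].

Definition scaled_simplex (R : numDomainType) (k : nat) : set 'rV[R]_3 :=
  [set t | \sum_i t 0 i = k%:R /\ forall i, 0 <= t 0 i].

Arguments newton_polyhedron R {n} f.
Arguments scaled_simplex R k : clear implicits.

Definition euclidean_dist (R : rcfType) (n : nat) (u v : 'rV[R]_n) : R :=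
  Num.sqrt (\sum_i (u 0 i - v 0 i) ^+ 2).

Definition equilateral_triangle (R : rcfType) (n : nat) (l : R)
    (S : set 'rV[R]_n) : Prop :=
  0 < l /\
  exists a b c : 'rV[R]_n,
    [/\ S = convex_hull [set a; b; c],
        euclidean_dist a b = l, euclidean_dist b c = l
      & euclidean_dist c a = l].

(* Integrality of p: it is the characteristic polynomial of an integral matrix.
   Up to conjugation by a diagonal matrix, p_entry X Y is the k x k circulant
   matrix with eigenvalues (u + eps ^ r v) ^ k, where X = u ^ k, Y = v ^ k. *)
Definition p_entry (A : comNzRingType) (k : nat) (X Y : A) (i j : nat) : A :=
  if (j < i)%N then Y *+ 'C(k, i - j)
  else X *+ 'C(k, j - i) + Y *+ (i == j).

Lemma p_entry_sum (A : comNzRingType) k (X Y t : A) (i : 'I_k) :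
  Y = X * t ^+ k ->
  \sum_(j < k) p_entry k X Y i j * t ^+ j = t ^+ i * (X * (1 + t) ^+ k).
Proof.
move=> eY; have ik : (i < k)%N := ltn_ord i; have ik' := ltnW ik.
rewrite -(big_mkord xpredT (fun j => p_entry k X Y i j * t ^+ j)).
rewrite (big_cat_nat (n := i)) //= exprDn.
rewrite -(big_mkord xpredT (fun d => 1 ^+ (k - d) * t ^+ d *+ 'C(k, d))).
rewrite [in RHS](big_cat_nat (n := (k - i)%N)) //=; last exact: leq_trans (leq_subr i k) (leqnSn k).
rewrite (big_nat_recr k) ?leq_subr //= binn mulr1n expr1n mul1r.
have -> : \sum_(0 <= j < i) p_entry k X Y i j * t ^+ j =
    t ^+ i * (X * \sum_(k - i <= d < k) 1 ^+ (k - d) * t ^+ d *+ 'C(k, d)).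
  rewrite -{1}[(k - i)%N]add0n big_addn subKn // !mulr_sumr.
  apply: eq_big_nat => j /andP[_ ji]; rewrite /p_entry ji eY expr1n mul1r.
  have -> : (j + (k - i) = k - (i - j))%N by rewrite subnBA ?(ltnW ji) // addnC addnBAC.
  rewrite bin_sub ?(leq_trans (leq_subr _ _)) // !mulrnAr !mulrnAl.
  congr (_ *+ _); rewrite mulrCA -mulrA -!exprD; congr (_ * t ^+ _).
  by rewrite subnBA ?(ltnW ji) // subnKC // (leq_trans ik') ?leq_addr.
have -> : \sum_(i <= j < k) p_entry k X Y i j * t ^+ j =
    t ^+ i * (X * \sum_(0 <= d < k - i) 1 ^+ (k - d) * t ^+ d *+ 'C(k, d))
    + Y * t ^+ i.
  rewrite -{1}[X in \sum_(X <= _ < _) _]add0n big_addn !mulr_sumr.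
  rewrite big_ltn ?subn_gt0 // [in RHS]big_ltn ?subn_gt0 //.
  rewrite addrAC; congr (_ + _).
    by rewrite /p_entry add0n ltnn subnn eqxx bin0 !expr1n expr0 !mulr1n; ring.
  apply: eq_big_nat => d /andP[d0 _].
  have di : (nat_of_ord i == d + i)%N = false.
    by rewrite -{1}[nat_of_ord i]add0n eqn_add2r ltn_eqF.
  rewrite /p_entry ltnNge leq_addl di addr0 addnK expr1n mul1r exprD.
  by rewrite !mulrnAr mulrnAl; rewrite mulrA mulrC.
rewrite eY; move: (\sum_(0 <= _ < _) _) (\sum_(_ <= _ < k) _) => a b.
by move: (t ^+ i) (t ^+ k) => ti tk; ring.
Qed.

Definition p_mx (A : comNzRingType) k (X Y z : A) : 'M[A]_k :=
  \matrix_(i, j) (z *+ (i == j) - p_entry k X Y i j).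

Lemma det_p_mx (C : numClosedFieldType) k (eps u v z : C) :
  k.-primitive_root eps ->
  \det (p_mx k (u ^+ k) (v ^+ k) z) =
  \prod_(1 <= r < k.+1) (z - (u + eps ^+ r * v) ^+ k).
Proof.
move=> prim; have k0 := prim_order_gt0 prim.
have epsX r : (eps ^+ r) ^+ k = 1 by rewrite exprAC (prim_expr_order prim) expr1n.
have kk : (k == 0%N) = false by rewrite eqn0Ngt k0.
have [->|u0] := eqVneq u 0.
  rewrite expr0n kk /= det_trig.
    rewrite (eq_bigr (fun=> z - v ^+ k)); last first.
      by move=> i _; rewrite mxE /p_entry ltnn !eqxx mul0rn add0r.
    rewrite big_const_ord big_add1 /= (eq_bigr (fun=> z - v ^+ k)); last first.
      by move=> r _; rewrite add0r exprMn epsX mul1r.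
    by rewrite big_const_nat subn0.
  apply/is_trig_mxP => i j ij; rewrite mxE /p_entry ltnNge ltnW //=.
  by rewrite (ltn_eqF ij) -(inj_eq val_inj) /= (ltn_eqF ij) mul0rn addr0 subr0.
have [->|v0] := eqVneq v 0.
  rewrite expr0n kk /= -det_tr det_trig.
    rewrite (eq_bigr (fun=> z - u ^+ k)); last first.
      by move=> i _; rewrite !mxE /p_entry ltnn !eqxx subnn bin0 addr0.
    rewrite big_const_ord big_add1 /= (eq_bigr (fun=> z - u ^+ k)); last first.
      by move=> r _; rewrite mulr0 addr0.
    by rewrite big_const_nat subn0.
  apply/is_trig_mxP => i j ij; rewrite !mxE /p_entry ij mul0rn subr0.
  by rewrite -(inj_eq val_inj) /= gtn_eqF.
pose t (r : 'I_k) := eps ^+ r.+1 * v / u.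
pose V := Vandermonde k (\row_r t r).
pose D : 'rV[C]_k := \row_r (z - (u + eps ^+ r.+1 * v) ^+ k).
have VD : p_mx k (u ^+ k) (v ^+ k) z *m V = V *m diag_mx D.
  apply/matrixP => i r; rewrite mul_mx_diag !mxE.
  under eq_bigr do rewrite !mxE mulrBl.
  rewrite sumrB p_entry_sum; last first.
    rewrite !exprMn epsX mul1r exprVn mulrCA mulfV ?mulr1 //.
    by rewrite expf_neq0.
  rewrite (bigD1 i) //= eqxx big1 ?addr0; last first.
    by move=> j ji; rewrite eq_sym (negPf ji) mul0r.
  rewrite -exprMn mulrDr mulr1 /t mulrC mulrBr; congr (_ - _ * _ ^+ _).
  by rewrite mulrC divfK.
have V0 : \det V != 0.
  rewrite det_Vandermonde; apply/prodf_neq0 => i _; apply/prodf_neq0 => j ij.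
  rewrite !mxE /t subr_eq0; apply/eqP => /(mulIf (invr_neq0 u0)) /(mulIf v0) /eqP.
  rewrite (eq_prim_root_expr prim) -(addn1 j) -(addn1 i) eqn_modDr !modn_small //.
  by rewrite gtn_eqF.
apply: (mulIf V0); rewrite -det_mulmx VD det_mulmx mulrC det_diag.
by congr (_ * _); rewrite big_add1 /= big_mkord; apply: eq_bigr => r _; rewrite mxE.
Qed.

Lemma is_p_exists (C : numClosedFieldType) (k : nat) (eps : C) :
  k.-primitive_root eps -> exists p : {mpoly int[3]}, is_p k eps p.
Proof.
move=> prim; have k0 := prim_order_gt0 prim.
pose X (i : 'I_3) : {mpoly int[3]} := 'X_i.
exists (\det (p_mx k ((-1) ^+ k * X 0) ((-1) ^+ k * X 1) (X 2%:R))) => x y z.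
rewrite -det_p_mx // !rootCK // -!det_map_mx; congr (\det _).
have sgn w : (map_mpoly (intr : int -> C) ((-1) ^+ k * X w))
    .@[tnth [tuple x; y; z]] = (-1) ^+ k * tnth [tuple x; y; z] w.
  by rewrite rmorphM rmorph_sign /= map_mpolyX mevalM rmorph_sign /= mevalXU.
apply/matrixP => i j; rewrite !mxE !(rmorphB, rmorphMn) /= map_mpolyX mevalXU.
congr (_ - _); rewrite /p_entry; case: ifP => _; rewrite ?(rmorphD, rmorphMn) /= !sgn //.
Qed.

(* Main.v *)
Require Import Defs.
From HB Require Import structures.
From mathcomp Require Import all_boot all_order all_algebra.
From mathcomp Require Import complex mpoly.
From mathcomp Require Import classical_sets reals convex.
From mathcomp Require Import interval_inference.

Set Implicit Arguments.
Unset Strict Implicit.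
Unset Printing Implicit Defensive.

Import Order.TTheory GRing.Theory Num.Theory.

Local Open Scope ring_scope.

(** The polynomial p is homogeneous of degree k, so every exponent of p lies in
the simplex; and the pure powers x^k, y^k, z^k, whose exponents are the three
corners of the simplex, occur in p. A convex set contained in the simplex and
containing its corners is the whole simplex, whence the Newton polyhedron; for
the same reason the simplex is the convex hull of its corners, which are at
mutual distance the square root of 2 times k.

Only the values of p are given, so both facts about coefficients are read off
from values. Doubling the arguments multiplies every factor of the product by
2, hence the value by 2^k ([is_p_dhomog]). This forces homogeneity because a
polynomial vanishing at all points is zero ([meval_eq0]), which holds over any
integral domain of characteristic zero, by Kronecker's substitution. For a homogeneous
polynomial, the coefficient of a pure power is the value at a coordinate vector
([mcoeff_pure_neq0]), and there the product is visibly nonzero ([is_p_pure]). *)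

Lemma base_digits_inj (n N : nat) (a b : 'I_n -> nat) :
  (forall i, a i < N)%N -> (forall i, b i < N)%N ->
  (\sum_i a i * N ^ i = \sum_i b i * N ^ i)%N -> a =1 b.
Proof.
elim: n a b => [|n IHn] a b aN bN; first by move=> _ [].
have N0 : (0 < N)%N by apply: leq_ltn_trans (aN ord0).
have digits (c : 'I_n.+1 -> nat) :
    (\sum_i c i * N ^ i = (\sum_(i < n) c (lift ord0 i) * N ^ i) * N + c ord0)%N.
  rewrite big_ord_recl expn0 muln1 addnC big_distrl; congr (_ + _)%N.
  by apply: eq_bigr => i _; rewrite lift0 expnSr mulnA.
rewrite !digits => eab.
have e0 : a ord0 = b ord0.
  by move: (congr1 (modn^~ N) eab); rewrite !modnMDl !modn_small.
move: eab; rewrite e0 => /addIn/eqP; rewrite eqn_pmul2r // => /eqP eab i.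
case: (unliftP ord0 i) => [j|] -> //.
exact: (IHn (fun j => a (lift ord0 j)) (fun j => b (lift ord0 j))).
Qed.

Lemma poly_eq0_nat (R : numDomainType) (q : {poly R}) :
  (forall t : R, q.[t] = 0) -> q = 0.
Proof.
move=> q0; pose rs : seq R := [seq i%:R | i <- iota 0 (size q)].
apply: (@roots_geq_poly_eq0 _ q rs).
- by apply/allP => t _; apply/rootP.
- by rewrite map_inj_uniq ?iota_uniq // => i j /eqP; rewrite eqr_nat => /eqP.
- by rewrite size_map size_iota.
Qed.

(** Kronecker's substitution: putting t^(N^i) for the i-th variable, with N larger
than every exponent, sends distinct monomials of f to distinct powers of t
(uniqueness of digits in base N). The univariate polynomial so obtained has the
same coefficients as f and infinitely many roots. *)
Lemma meval_eq0 (R : numDomainType) (n : nat) (f : {mpoly R[n]}) :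
  (forall v, f.@[v] = 0) -> f = 0.
Proof.
move=> f0; set N := msize f.
pose w (m : 'X_{1..n}) := (\sum_i m i * N ^ i)%N.
have supp_lt m : m \in msupp f -> forall i, (m i < N)%N.
  move=> mf i; apply: leq_ltn_trans (msize_mdeg_lt mf).
  by rewrite mdegE (bigD1 i) //= leq_addr.
pose q : {poly R} := \sum_(m <- msupp f) f@_m *: 'X^(w m).
have q0 : q = 0.
  apply: poly_eq0_nat => t; rewrite -[RHS](f0 (fun i => t ^+ (N ^ i))).
  rewrite horner_sum mevalE; apply: eq_bigr => m _.
  rewrite hornerZ hornerXn /w expr_sum; congr (_ * _).
  by apply: eq_bigr => i _; rewrite -exprM mulnC.
apply/mpolyP => m; rewrite mcoeff0.
have [mf|] := boolP (m \in msupp f); last exact: memN_msupp_eq0.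
have := congr1 (fun q : {poly R} => q`_(w m)) q0; rewrite coef0 => <-.
rewrite coef_sum (bigD1_seq m) ?msupp_uniq //= big1_seq ?addr0.
  by rewrite coefZ coefXn eqxx mulr1.
move=> m' /andP[m'm m'f]; rewrite coefZ coefXn.
have [e|] := eqVneq; last by rewrite mulr0.
case/eqP: m'm; apply/mnmP => i; apply/esym.
exact: (base_digits_inj (supp_lt _ mf) (supp_lt _ m'f)).
Qed.

(** The factor 2 suffices: the polynomial whose coefficient at m is
(2 ^ deg m - 2 ^ d) times that of f vanishes everywhere, and e |-> 2 ^ e is
injective. *)
Lemma dhomog_double (R : numDomainType) (n d : nat) (f : {mpoly R[n]}) :
  (forall v, f.@[fun i => 2 * v i] = 2 ^+ d * f.@[v]) -> f \is d.-homog.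
Proof.
move=> f2; pose c (m : 'X_{1..n}) : R := 2 ^+ mdeg m - 2 ^+ d.
pose g : {mpoly R[n]} := \sum_(m <- msupp f) (c m * f@_m) *: 'X_[m].
have g0 : g = 0.
  apply: meval_eq0 => v; move/(_ v)/eqP: f2; rewrite -subr_eq0 => /eqP <-.
  rewrite raddf_sum /= !mevalE mulr_sumr -sumrB; apply: eq_bigr => m _.
  rewrite mevalZ mevalX.
  have -> : \prod_i (2 * v i) ^+ m i = 2 ^+ mdeg m * \prod_i v i ^+ m i.
    by rewrite mdegE expr_sum -big_split; apply: eq_bigr => i _; rewrite exprMn.
  by rewrite /c !mulrBl; congr (_ - _); rewrite -?mulrA // mulrCA.
apply/dhomogP => m mf; have /mpolyP/(_ m) := g0.
rewrite mcoeff0 raddf_sum /= (bigD1_seq m) ?msupp_uniq //= big1 ?addr0.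
  rewrite mcoeffZ mcoeffX eqxx mulr1 => /eqP.
  rewrite mulf_eq0 -[f@__ == 0]negbK -mcoeff_msupp mf orbF subr_eq0.
  by rewrite (inj_eq (ieexprIn _ _)) ?ltr0n ?pnatr_eq1 // => /eqP.
by move=> m' /negPf m'm; rewrite mcoeffZ mcoeffX m'm mulr0.
Qed.

(** Among the monomials of degree d, only the d-th power of the i-th variable is
nonzero at the i-th coordinate vector. *)
Lemma mcoeff_pure_neq0 (R : comNzRingType) (n d : nat) (f : {mpoly R[n]})
    (i : 'I_n) :
  f \is d.-homog -> f.@[fun j => (i == j)%:R] != 0 -> f@_(U_(i) *+ d) != 0.
Proof.
move=> fd; apply: contra => /eqP fi; rewrite mevalE big1_seq // => m /= mf.
have [e|/eqP ne] := eqVneq m (U_(i) *+ d)%MM; first by rewrite e fi mul0r.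
have [j /andP[ij mj]] : exists j, (i != j) && (m j != 0%N).
  apply/existsP; apply: contraT; rewrite negb_exists => /forallP h; case: ne.
  have m0 j : i != j -> m j = 0%N.
    by move=> ij; have := h j; rewrite ij negbK => /eqP.
  apply/mnmP => j; rewrite mulmnE mnm1E.
  case: eqVneq => [<-|/m0] //; rewrite mul1n -(dhomog_mf fd mf) /= mdegE.
  by rewrite (bigD1 i) //= big1 ?addn0 // => l li; rewrite m0 // eq_sym.
by rewrite (bigD1 j) //= (negPf ij) expr0n (negPf mj) mul0r mulr0.
Qed.

Lemma is_p_meval (C : numClosedFieldType) (k : nat) (eps : C)
    (p : {mpoly int[3]}) (v : 'I_3 -> C) :
  is_p k eps p -> (map_mpoly intr p).@[v] =
  \prod_(1 <= r < k.+1) (v 2 - (k.-root ((-1) ^+ k * v 0)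
     + eps ^+ r * k.-root ((-1) ^+ k * v 1)) ^+ k).
Proof.
move=> hp; rewrite -hp; apply: meval_eq => i.
by case: i => -[|[|[|//]]] lti; rewrite (tnth_nth 0) /=; congr v; apply: val_inj.
Qed.

(** Scaling x, y and z by 2 multiplies both k-th roots by the k-th root of 2,
hence each factor of the product by 2. A positive scalar is taken because the
chosen branch of the k-th root need not be multiplicative for other scalars. *)
Lemma is_p_dhomog (C : numClosedFieldType) (k : nat) (eps : C)
    (p : {mpoly int[3]}) :
  (0 < k)%N -> is_p k eps p -> p \is k.-homog.
Proof.
move=> k0 hp.
suff : map_mpoly (intr : int -> C) p \is k.-homog.
  move=> /dhomogP ph; apply/dhomogP => m mp; apply: ph.
  by rewrite mcoeff_msupp mcoeff_map_mpoly intr_eq0 -mcoeff_msupp.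
apply: dhomog_double => v; rewrite !(is_p_meval _ hp).
have -> : (2 : C) ^+ k = \prod_(1 <= r < k.+1) 2.
  by rewrite big_const_nat subn1 iter_mulr_1.
rewrite -big_split; apply: eq_bigr => r _ /=.
rewrite !(mulrCA _ 2) !(rootCMl _ _ (ler0n C 2)) (mulrCA _ (k.-root 2)) -mulrDr.
by rewrite exprMn rootCK // mulrBr.
Qed.

(** At a coordinate vector two of the variables vanish, so every factor of the
product is 1 or minus the k-th power of a nonzero number. *)
Lemma is_p_pure (C : numClosedFieldType) (k : nat) (eps : C)
    (p : {mpoly int[3]}) (i : 'I_3) :
  k.-primitive_root eps -> is_p k eps p -> p@_(U_(i) *+ k) != 0.
Proof.
move=> prim hp; have k0 := prim_order_gt0 prim.
rewrite -(intr_eq0 C) -mcoeff_map_mpoly; apply: mcoeff_pure_neq0.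
  apply/dhomogP => m; rewrite mcoeff_msupp mcoeff_map_mpoly intr_eq0.
  by rewrite -mcoeff_msupp; apply/dhomogP/(is_p_dhomog k0 hp).
have eps0 : eps != 0.
  apply/eqP => e0; have /eqP := prim_expr_order prim.
  by rewrite e0 expr0n eqn0Ngt k0 eq_sym oner_eq0.
rewrite (is_p_meval _ hp) prodf_seq_neq0; apply/allP => r _ /=.
have sgn_neq0 : k.-root ((-1) ^+ k : C) != 0.
  by rewrite rootC_eq0 // expf_neq0 // oppr_eq0 oner_neq0.
case: i => -[|[|[|//]]] lti /=.
- by rewrite mulr1 mulr0 rootC0 mulr0 addr0 sub0r oppr_eq0 expf_neq0.
- by rewrite mulr1 mulr0 rootC0 !add0r oppr_eq0 expf_neq0 // mulf_neq0 // expf_neq0.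
- by rewrite mulr0 rootC0 mulr0 addr0 expr0n eqn0Ngt k0 subr0 oner_neq0.
Qed.

(** Convexity speaks of two points only. The first point is split off and the
other weights are rescaled by their sum, unless that sum is zero. *)
Lemma convex_set_sum (R : numFieldType) (M : lmodType R) (A : set M) (n : nat)
    (c : 'I_n -> R) (x : 'I_n -> M) :
  convex_set A -> (forall i, A (x i)) -> (forall i, 0 <= c i) ->
  \sum_i c i = 1 -> A (\sum_i c i *: x i).
Proof.
move=> cA; elim: n c x => [|n IHn] c x Ax c0.
  by rewrite big_ord0 => /esym/eqP; rewrite oner_eq0.
rewrite !big_ord_recl => c1; set s := \sum_(i < n) c (lift ord0 i) in c1.
have s0 : 0 <= s by apply: sumr_ge0.
have es : s = 1 - c ord0 by rewrite -c1 addrC addKr.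
have [sz|sn] := eqVneq s 0.
  have ci i : c (lift ord0 i) = 0.
    by apply/eqP; move/eqP: sz; rewrite psumr_eq0 // => /allP/(_ i (mem_index_enum _)).
  rewrite big1 => [|i _]; last by rewrite ci scale0r.
  by move: c1; rewrite sz !addr0 => ->; rewrite scale1r.
have c01 : c ord0 <= 1 by rewrite -subr_ge0 -es.
have Ay : A (\sum_(i < n) (c (lift ord0 i) / s) *: x (lift ord0 i)).
  apply: IHn => [//|i|]; first by rewrite divr_ge0.
  by rewrite -mulr_suml divff.
have := cA _ _ (Itv01 (c0 ord0) c01) (mem_set (Ax ord0)) (mem_set Ay).
rewrite inE /conv /=; congr A; congr (_ + _).
rewrite /unstable.onem -es scaler_sumr; apply: eq_bigr => i _.
by rewrite scalerA mulrC divfK.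
Qed.

Definition corner (R : numDomainType) (k : nat) (i : 'I_3) : 'rV[R]_3 :=
  \row_j (k * (i == j))%:R.

Lemma scaled_simplex_convex (R : numDomainType) (k : nat) :
  @convex_set R 'rV[R]_3 (scaled_simplex R k).
Proof.
move=> u v l /set_mem[su u0] /set_mem[sv v0]; apply/mem_set; split.
  rewrite /conv /=; under eq_bigr do rewrite !mxE.
  by rewrite big_split -!mulr_sumr /= su sv -mulrDl addrC subrK mul1r.
by move=> i; rewrite !mxE addr_ge0 // mulr_ge0 ?subr_ge0.
Qed.

Lemma corner_in_simplex (R : numDomainType) (k : nat) (i : 'I_3) :
  scaled_simplex R k (corner R k i).
Proof.
split=> [|j]; last by rewrite mxE ler0n.
rewrite (bigD1 i) //= big1 ?addr0 => [|j /negPf ji].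
  by rewrite mxE eqxx muln1.
by rewrite mxE eq_sym ji muln0.
Qed.

(** A point t of the simplex is the combination of the corners with weights
t_i / k. Taking A arbitrary covers both the exponents of a polynomial and the set
of the three corners. *)
Lemma convex_hull_simplex (R : numFieldType) (k : nat) (A : set 'rV[R]_3) :
  (0 < k)%N -> (forall i, A (corner R k i)) ->
  subset A (scaled_simplex R k) -> convex_hull A = scaled_simplex R k.
Proof.
move=> k0 Ac AS; apply/seteqP; split=> [|t [st t0] B [cB AB]].
  exact: smallest_sub (@scaled_simplex_convex R k) AS.
have kn : k%:R != 0 :> R by rewrite pnatr_eq0 -lt0n.
have -> : t = \sum_i (t 0 i / k%:R) *: corner R k i.
  apply/rowP => j; rewrite summxE (bigD1 j) //= big1 ?addr0 => [|i /negPf ij].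
    by rewrite !mxE eqxx muln1 divfK.
  by rewrite !mxE ij muln0 mulr0.
apply: convex_set_sum => // [i|i|]; first exact/AB/Ac.
  by rewrite divr_ge0 ?ler0n.
by rewrite -mulr_suml st divff.
Qed.

Lemma corner_dist (R : rcfType) (k : nat) (i j : 'I_3) :
  i != j -> euclidean_dist (corner R k i) (corner R k j) = Num.sqrt 2 * k%:R.
Proof.
move=> ij; rewrite /euclidean_dist (bigD1 i) //= (bigD1 j) 1?eq_sym //=.
rewrite big1 => [|l /andP[li lj]]; last first.
  rewrite !mxE ![_ == l]eq_sym (negPf li) (negPf lj).
  by rewrite muln0 subrr expr0n.
rewrite !mxE !eqxx (negPf ij) eq_sym (negPf ij) muln0 muln1 addr0.
rewrite subr0 sub0r sqrrN -mulr2n -[_ ^+ 2 *+ 2]mulr_natl sqrtrM ?ler0n //.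
by rewrite sqrtr_sqr ger0_norm ?ler0n.
Qed.

Theorem corollary3p6 (R : realType) (k : nat) (eps : R[i]) (p : {mpoly int[3]})
    (hk : (1 <= k)%N) (heps : k.-primitive_root eps) (hp : is_p k eps p) :
  newton_polyhedron R p = scaled_simplex R k /\
  equilateral_triangle (Num.sqrt 2 * k%:R) (scaled_simplex R k).
Proof.
split.
  apply: convex_hull_simplex => // [i|_ [m /= pm <-]].
    exists (U_(i) *+ k)%MM; first exact: is_p_pure heps hp.
    by apply/rowP => j; rewrite !mxE mulmnE mnm1E mulnC.
  have /= <- := dhomog_mf (is_p_dhomog hk hp) (etrans (mcoeff_msupp _ _) pm).
  split=> [|i]; last by rewrite mxE ler0n.
  by rewrite mdegE natr_sum; apply: eq_bigr => i _; rewrite mxE.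
split; first by rewrite mulr_gt0 ?sqrtr_gt0 ?ltr0n.
exists (corner R k 0), (corner R k 1), (corner R k 2); split.
- apply/esym/convex_hull_simplex => // [i|_ [[]|] ->]; last 3 first.
  + exact: corner_in_simplex.
  + exact: corner_in_simplex.
  + exact: corner_in_simplex.
  by case: i => -[|[|[|//]]] lti; [left; left|left; right|right];
    congr corner; apply: val_inj.
- exact: corner_dist.
- exact: corner_dist.
- exact: corner_dist.
Qed.
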